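(* Let $\mathcal{H}$ be a complex Hilbert space and let $A,B\in\mathcal{B}(\mathcal{H})$. Assume that $$|A+B|_{\mathrm{qsym}}=|A|_{\mathrm{qsym}}+|B|_{\mathrm{qsym}}.$$ Define the linear lifting $\Gamma:\mathcal{B}(\mathcal{H})\to\mathcal{B}(\mathcal{H},\mathcal{H}\oplus\mathcal{H})$ by $$\Gamma(T):=\frac{1}{\sqrt2}\begin{pmatrix}T\\ T^*\end{pmatrix}.$$ Then there exists a partial isometry $W\in\mathcal{B}(\mathcal{H},\mathcal{H}\oplus\mathcal{H})$ such that $$\Gamma(A)=W\,|A|_{\mathrm{qsym}},\qquad \Gamma(B)=W\,|B|_{\mathrm{qsym}}.$$ Equivalently, $\Gamma(A)$ and $\Gamma(B)$ admit polar decompositions sharing a common partial isometry factor.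
   Context: $\mathcal{B}(\mathcal{H},\mathcal{K})$ is the space of bounded linear operators between complex Hilbert spaces, $\mathcal{B}(\mathcal{H})=\mathcal{B}(\mathcal{H},\mathcal{H})$. For $X\in\mathcal{B}(\mathcal{H},\mathcal{K})$, $|X|=(X^*X)^{1/2}$. For $T\in\mathcal{B}(\mathcal{H})$, $|T|_{\mathrm{qsym}}=\left(\frac{T^*T+TT^*}{2}\right)^{1/2}$; thus $|\Gamma(T)|=|T|_{\mathrm{qsym}}$. A partial isometry is an operator $W$ such that $W^*W$ is an orthogonal projection. ''Polar decomposition of $X$ with partial isometry factor $W$'' here means a factorization $X=W|X|$ with $W$ a partial isometry (the initial projection of $W$ is not required to equal the support projection of $|X|$). *)

(* Defs.v *)
From HB Require Import structures.
From mathcomp Require Import all_boot all_order all_algebra.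
From mathcomp Require Import sesquilinear complex.
From mathcomp Require Import all_classical all_reals all_analysis.
From mathcomp Require Import ring.

Set Implicit Arguments.
Unset Strict Implicit.
Unset Printing Implicit Defensive.

Import Order.TTheory GRing.Theory Num.Theory.
Import numFieldNormedType.Exports.

Local Open Scope classical_set_scope.
Local Open Scope ring_scope.
Local Open Scope complex_scope.

(* The inner product is linear in its first argument and conjugate-linear in
   the second one. *)
HB.mixin Record NormedModule_isInner (R : realType) V & NormedModule R[i] V := {
  inner : {dot V for (@Num.conj R[i])};
  inner_normE : forall x : V, `|x| ^+ 2 = inner x x
}.

#[short(type="hilbertType")]
HB.structure Definition Hilbert (R : realType) :=
  {V of CompleteNormedModule R[i] V & NormedModule_isInner R V}.

Notation "''[' x , y ]" := (inner x y) : ring_scope.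

(* Hilbert direct sum. A type alias is needed because the library equips the
   bare product with the max norm, which comes from no inner product. *)
Definition hsum (R : realType) (H K : hilbertType R) : Type := (H * K)%type.

Section HilbertSum.
Variables (R : realType) (H K : hilbertType R).
Local Notation S := (hsum H K).

HB.instance Definition _ := GRing.Lmodule.copy S (H * K)%type.

Definition hsum_inner (x y : S) : R[i] := '[x.1, y.1] + '[x.2, y.2].

Definition hsum_norm (x : S) : R[i] := sqrtC (`|x.1| ^+ 2 + `|x.2| ^+ 2).

Lemma hsum_norm_sqr x : hsum_norm x ^+ 2 = `|x.1| ^+ 2 + `|x.2| ^+ 2.
Proof. exact: sqrtCK. Qed.

Lemma hsum_norm_ge0 x : 0 <= hsum_norm x.
Proof. by rewrite sqrtC_ge0 addr_ge0// exprn_ge0. Qed.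

Lemma hsum_norm_fst x : `|x.1| <= hsum_norm x.
Proof.
rewrite -(ler_pXn2r (n := 2))// ?nnegrE ?hsum_norm_ge0//.
by rewrite hsum_norm_sqr lerDl exprn_ge0.
Qed.

Lemma hsum_norm_snd x : `|x.2| <= hsum_norm x.
Proof.
rewrite -(ler_pXn2r (n := 2))// ?nnegrE ?hsum_norm_ge0//.
by rewrite hsum_norm_sqr lerDr exprn_ge0.
Qed.

Lemma hsum_norm_le x : hsum_norm x <= `|x.1| + `|x.2|.
Proof.
rewrite -(ler_pXn2r (n := 2))// ?nnegrE ?hsum_norm_ge0 ?addr_ge0//.
by rewrite hsum_norm_sqr sqrrD addrAC lerDl mulrn_wge0// mulr_ge0.
Qed.

Lemma hsum_ler_normD x y : hsum_norm (x + y) <= hsum_norm x + hsum_norm y.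
Proof.
have minkowski (a b c d : R[i]) : 0 <= a -> 0 <= b -> 0 <= c -> 0 <= d ->
    sqrtC ((a + b) ^+ 2 + (c + d) ^+ 2) <=
    sqrtC (a ^+ 2 + c ^+ 2) + sqrtC (b ^+ 2 + d ^+ 2).
  move=> a0 b0 c0 d0.
  have ac0 : 0 <= a ^+ 2 + c ^+ 2 by rewrite addr_ge0// exprn_ge0.
  have bd0 : 0 <= b ^+ 2 + d ^+ 2 by rewrite addr_ge0// exprn_ge0.
  have cs : a * b + c * d <= sqrtC (a ^+ 2 + c ^+ 2) * sqrtC (b ^+ 2 + d ^+ 2).
    rewrite -(ler_pXn2r (n := 2))// ?nnegrE ?mulr_ge0 ?addr_ge0 ?mulr_ge0 ?sqrtC_ge0//.
    rewrite exprMn !sqrtCK -subr_ge0.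
    have -> : (a ^+ 2 + c ^+ 2) * (b ^+ 2 + d ^+ 2) - (a * b + c * d) ^+ 2 =
              (a * d - c * b) ^+ 2 by ring.
    by rewrite real_exprn_even_ge0// rpredB// rpredM// ger0_real.
  rewrite -(ler_pXn2r (n := 2))// ?nnegrE ?addr_ge0 ?sqrtC_ge0//;
    last by rewrite addr_ge0// exprn_ge0// addr_ge0.
  rewrite [leRHS]sqrrD !sqrtCK -subr_ge0.
  have -> : a ^+ 2 + c ^+ 2 +
      sqrtC (a ^+ 2 + c ^+ 2) * sqrtC (b ^+ 2 + d ^+ 2) *+ 2 + (b ^+ 2 + d ^+ 2) -
      ((a + b) ^+ 2 + (c + d) ^+ 2) =
      (sqrtC (a ^+ 2 + c ^+ 2) * sqrtC (b ^+ 2 + d ^+ 2) - (a * b + c * d)) *+ 2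
    by ring.
  by rewrite mulrn_wge0// subr_ge0.
apply: le_trans (minkowski _ _ _ _ _ _ _ _) => //.
have sum0 : 0 <= (`|x.1| + `|y.1|) ^+ 2 + (`|x.2| + `|y.2|) ^+ 2.
  by rewrite addr_ge0// exprn_ge0// addr_ge0.
rewrite -(ler_pXn2r (n := 2))// ?nnegrE ?hsum_norm_ge0 ?sqrtC_ge0//.
rewrite hsum_norm_sqr sqrtCK/=.
by rewrite lerD// ler_pXn2r// ?nnegrE ?addr_ge0// ler_normD.
Qed.

Lemma hsum_normZ (l : R[i]) x : hsum_norm (l *: x) = `|l| * hsum_norm x.
Proof.
apply: (pexpIrn (n := 2)); rewrite ?nnegrE ?mulr_ge0 ?hsum_norm_ge0//.
by rewrite exprMn !hsum_norm_sqr/= !normrZ !exprMn mulrDr.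
Qed.

Lemma hsum_normr0_eq0 x : hsum_norm x = 0 -> x = 0.
Proof.
move=> x0; have := hsum_norm_fst x; have := hsum_norm_snd x.
by rewrite x0 !normr_le0; case: x {x0} => a b /= /eqP-> /eqP->.
Qed.

HB.instance Definition _ := Lmodule_isNormed.Build R[i] S
  hsum_ler_normD hsum_normZ hsum_normr0_eq0.

Lemma hsum_normE (x : S) : `|x| = hsum_norm x. Proof. by []. Qed.

Lemma hsum_ballE (x y : S) e : ball x e y = (`|x - y| < e) :> Prop.
Proof. by rewrite -ball_normE. Qed.

Lemma hsum_complete (F : set_system S) : ProperFilter F -> cauchy F -> cvg F.
Proof.
move=> FF /cauchy_ballP Fc.
have cauchy_proj (V : hilbertType R) (p : S -> V) :
    (forall x y, `|p x - p y| <= `|x - y|) -> cauchy (p @ F).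
  move=> p_le; apply/cauchy_ballP => e e0.
  rewrite near_map2; apply: filterS (Fc _ e0) => -[x y] /=.
  rewrite -!ball_normE/=; exact: le_lt_trans.
have fst_cvg : cvg ((fun x : S => x.1) @ F).
  by apply: cauchy_cvg; apply: cauchy_proj => x y; exact: (hsum_norm_fst (x - y)).
have snd_cvg : cvg ((fun x : S => x.2) @ F).
  by apply: cauchy_cvg; apply: cauchy_proj => x y; exact: (hsum_norm_snd (x - y)).
case/cvg_ex: fst_cvg => a Fa; case/cvg_ex: snd_cvg => b Fb.
apply/cvg_ex; exists ((a, b) : S); apply/cvgrPdist_lt => e e0.
have e20 : 0 < e / 2 by rewrite divr_gt0.
move/cvgrPdist_lt : Fa => /(_ _ e20) Fa.
move/cvgrPdist_lt : Fb => /(_ _ e20) Fb.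
apply: filterS2 Fa Fb => x xa xb /=.
rewrite hsum_normE (le_lt_trans (hsum_norm_le _))// (splitr e).
exact: ltrD xa xb.
Qed.

HB.instance Definition _ := Uniform_isComplete.Build S hsum_complete.

Lemma hsum_inner_zmodl (y : S) : zmod_morphism (hsum_inner ^~ y).
Proof. by move=> u v; rewrite /hsum_inner/= !linearBl/= addrACA opprD. Qed.

Lemma hsum_inner_zmodr (x : S) : zmod_morphism (hsum_inner x).
Proof. by move=> u v; rewrite /hsum_inner/= !linearBr/= addrACA opprD. Qed.

Lemma hsum_inner_scalel (y : S) : scalable_for ( *%R) (hsum_inner ^~ y).
Proof. by move=> a u; rewrite /hsum_inner/= !linearZl_LR/= mulrDr. Qed.

Lemma hsum_inner_scaler (x : S) :
  scalable_for ((@Num.conj R[i]) \; *%R) (hsum_inner x).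
Proof. by move=> a u; rewrite /hsum_inner/= !linearZr_LR/= mulrDr. Qed.

HB.instance Definition _ := isBilinear.Build R[i] S S R[i]
  ( *%R) ((@Num.conj R[i]) \; *%R) hsum_inner hsum_inner_zmodl
  hsum_inner_zmodr hsum_inner_scalel hsum_inner_scaler.

Lemma hsum_innerC (x y : S) :
  hsum_inner x y = (-1) ^+ false * Num.conj (hsum_inner y x).
Proof.
rewrite /hsum_inner expr0 mul1r rmorphD/=.
by rewrite [in LHS]hermC [X in _ + X]hermC !expr0 !mul1r.
Qed.

HB.instance Definition _ := isHermitianSesquilinear.Build R[i] S false
  (@Num.conj R[i]) hsum_inner hsum_innerC.

Lemma hsum_inner_normE (x : S) : `|x| ^+ 2 = hsum_inner x x.
Proof. by rewrite hsum_normE hsum_norm_sqr !inner_normE. Qed.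

Lemma hsum_inner_gt0 (x : S) : x != 0 -> 0 < hsum_inner x x.
Proof. by move=> x0; rewrite -hsum_inner_normE exprn_gt0// normr_gt0. Qed.

HB.instance Definition _ := isDotProduct.Build R[i] S hsum_inner hsum_inner_gt0.

HB.instance Definition _ := NormedModule_isInner.Build R S hsum_inner_normE.

End HilbertSum.

Section BoundedOperators.
Variables (R : realType) (H K : hilbertType R).

Definition bounded_linear : {pred H -> K} := fun f =>
  `[< linear f /\ exists M : R, forall x, `|f x| <= M%:C * `|x| >].

Lemma bounded_linear_submod_closed : submod_closed bounded_linear.
Proof.
split=> [|a f g /asboolP[lf [M fM]] /asboolP[lg [N gN]]]; apply/asboolP; split.
- by move=> a x y; rewrite scaler0 addr0.
- by exists 0 => x; rewrite normr0 mul0r.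
- move=> b x y; rewrite !fctE lf lg scalerDr scalerA [a * b]mulrC -scalerA.
  by rewrite scalerDr addrACA.
- have /complex_realP[r ar] := normr_real a.
  exists (r * M + N) => x; rewrite rmorphD rmorphM/= -ar.
  rewrite mulrDl -mulrA (le_trans (ler_normD _ _))// lerD//.
  by rewrite normrZ ler_wpM2l.
Qed.

HB.instance Definition _ := GRing.isSubmodClosed.Build R[i] (H -> K)
  bounded_linear bounded_linear_submod_closed.

Record bop := Bop { bop_fun :> H -> K; bopP : bop_fun \in bounded_linear }.

HB.instance Definition _ := [isSub for bop_fun].
HB.instance Definition _ := [Choice of bop by <:].
HB.instance Definition _ := [SubChoice_isSubLmodule of bop by <:].

Lemma bop_linear (T : bop) : linear T.
Proof. by case: T => f /= /asboolP[]. Qed.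

HB.instance Definition _ (T : bop) :=
  GRing.isLinear.Build R[i] H K *:%R (bop_fun T) (bop_linear T).

Lemma bop_bounded (T : bop) : exists M : R, forall x, `|T x| <= M%:C * `|x|.
Proof. by case: T => f /= /asboolP[]. Qed.

Lemma bop_bounded_ge0 (T : bop) :
  exists2 M : R, 0 <= M & forall x, `|T x| <= M%:C * `|x|.
Proof.
have [M TM] := bop_bounded T; exists `|M| => // x.
by rewrite (le_trans (TM x))// ler_wpM2r// lecR ler_norm.
Qed.

End BoundedOperators.

Notation "''B(' H , K )" := (bop H K)
  (at level 8, format "''B(' H ,  K )") : type_scope.

Section Operations.
Variable R : realType.
Implicit Types H K L : hilbertType R.

Lemma bop_comp_subproof H K L (S : 'B(K, L)) (T : 'B(H, K)) :
  (fun x => S (T x)) \in @bounded_linear R H L.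
Proof.
apply/asboolP; split=> [a x y|]; first by rewrite !linearP.
have [M M0 SM] := bop_bounded_ge0 S; have [N _ TN] := bop_bounded_ge0 T.
exists (M * N) => x; rewrite (le_trans (SM _))// rmorphM/= -mulrA.
by rewrite ler_wpM2l// lecR.
Qed.

Definition bop_comp H K L (S : 'B(K, L)) (T : 'B(H, K)) : 'B(H, L) :=
  Bop (bop_comp_subproof S T).

Lemma bop_col_subproof H K L (S : 'B(H, K)) (T : 'B(H, L)) :
  (fun x => (S x, T x) : hsum K L) \in @bounded_linear R H (hsum K L).
Proof.
apply/asboolP; split=> [a x y|]; first by rewrite !linearP.
have [M M0 SM] := bop_bounded_ge0 S; have [N N0 TN] := bop_bounded_ge0 T.
exists (M + N) => x; rewrite hsum_normE (le_trans (hsum_norm_le _))//.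
by rewrite rmorphD/= mulrDl lerD.
Qed.

Definition bop_col H K L (S : 'B(H, K)) (T : 'B(H, L)) : 'B(H, hsum K L) :=
  Bop (bop_col_subproof S T).

End Operations.

Notation "S *o T" := (bop_comp S T)
  (at level 40, left associativity, format "S  *o  T") : ring_scope.

Section Moduli.
Variable R : realType.
Implicit Types H K : hilbertType R.

(* The adjoint exists and is unique (Riesz), so the default value 0 is never
   taken. *)
Definition adjoint H K (T : 'B(H, K)) : 'B(K, H) :=
  xget 0 [set S : 'B(K, H) | forall x y, '[T x, y] = '[x, S y]].

(* In the order of R[i], 0 <= z says that z is real and nonnegative; over the
   complex numbers this forces self-adjointness. *)
Definition positive_op H (T : 'B(H, H)) := forall x : H, 0 <= '[T x, x].

(* The positive square root of a positive operator exists and is unique; the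
   default value 0 is only taken at operators that are not positive. *)
Definition op_sqrt H (T : 'B(H, H)) : 'B(H, H) :=
  xget 0 [set S : 'B(H, H) | positive_op S /\ S *o S = T].

Definition op_abs H K (X : 'B(H, K)) : 'B(H, H) := op_sqrt (adjoint X *o X).

Definition op_qsym H (T : 'B(H, H)) : 'B(H, H) :=
  op_sqrt (2^-1 *: (adjoint T *o T + T *o adjoint T)).

Definition orth_projection H (P : 'B(H, H)) := P *o P = P /\ adjoint P = P.

Definition partial_isometry H K (W : 'B(H, K)) :=
  orth_projection (adjoint W *o W).

(* The initial projection of W need not be the support projection of op_abs X. *)
Definition polar_decomposition H K (X W : 'B(H, K)) :=
  partial_isometry W /\ X = W *o op_abs X.

Definition lifting H (T : 'B(H, H)) : 'B(H, hsum H H) :=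
  (sqrtC 2)^-1 *: bop_col T (adjoint T).

End Moduli.

(* Main.v *)
Require Import Defs.
From HB Require Import structures.
From mathcomp Require Import all_boot all_order all_algebra.
From mathcomp Require Import sesquilinear complex.
From mathcomp Require Import all_classical all_reals all_analysis.
From mathcomp Require Import ring lra.

(* Write X = lifting A, Y = lifting B, P = |X|, Q = |Y|. The qsym modulus of T
   is |lifting T|, so the hypothesis says |X + Y| = P + Q, and X + Y = W (P + Q)
   for a partial isometry W. Put E = W^* X - P, so that W^* Y = Q - E. As W^* is
   a contraction, for every v
     2 Re <P v, E v> + |E v|^2 <= 0   and   |E v|^2 <= 2 Re <Q v, E v>.
   For T = 1 + e E with e > 0 small, the form of P then drops along T by at
   least (e/2) |E v|^2, while the form of Q grows by at least e |E v|^2. The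
   vectors E T^n v = T^n E v are square-summable by the first fact, so
   <Q T^n E v, T^n E v>, which is nondecreasing in n, tends to 0 and hence
   vanishes; the second fact gives E^2 = 0, the vectors E T^n v are all equal
   to E v, and E = 0. From W^* X = P and |X v| = |P v| follows X = W P, and
   similarly Y = W Q. *)

Local Open Scope ring_scope.

Section TriangleEquality.

Set Implicit Arguments.
Unset Strict Implicit.
Unset Printing Implicit Defensive.
Import Order.TTheory GRing.Theory Num.Theory.
Import numFieldNormedType.Exports.
Local Open Scope classical_set_scope.
Local Open Scope ring_scope.
Local Open Scope complex_scope.

Variable R : realType.
Implicit Types H K L : hilbertType R.

(** * Real inner products and pointwise rules for bounded operators *)

(* Complex identities are recovered from the real part through rip_inner and
   inner_eq_of_rip. *)
Definition rip H (x y : H) : R := complex.Re '[x, y].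

Lemma ripC H (x y : H) : rip x y = rip y x.
Proof. by rewrite /rip hermC expr0 mul1r /=; case: '[y, x]. Qed.

Lemma ripDl H (x y z : H) : rip (x + y) z = rip x z + rip y z.
Proof. by rewrite /rip linearDl /=; case: '[x, z]; case: '[y, z]. Qed.

Lemma ripNl H (x z : H) : rip (- x) z = - rip x z.
Proof. by rewrite /rip linearNl /=; case: '[x, z]. Qed.

Lemma ripZl H (r : R) (x z : H) : rip (r%:C *: x) z = r * rip x z.
Proof.
by rewrite /rip linearZl_LR /=; case: '[x, z] => a b /=; rewrite mul0r subr0.
Qed.

Lemma ripDr H (x y z : H) : rip z (x + y) = rip z x + rip z y.
Proof. by rewrite ripC ripDl !(ripC z). Qed.

Lemma ripNr H (x z : H) : rip z (- x) = - rip z x.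
Proof. by rewrite ripC ripNl ripC. Qed.

Lemma ripZr H (r : R) (x z : H) : rip z (r%:C *: x) = r * rip z x.
Proof. by rewrite ripC ripZl ripC. Qed.

Lemma ripir H (x y : H) : rip x ('i%C *: y) = complex.Im '[x, y].
Proof. by rewrite /rip linearZr_LR /=; case: '[x, y] => a b /=; lra. Qed.

Lemma sq_norm H (x : H) : `|x| ^+ 2 = (rip x x)%:C.
Proof. by rewrite /rip -inner_normE RRe_real// rpredX// normr_real. Qed.

Lemma bopDE H K (S T : 'B(H, K)) x : (S + T) x = S x + T x.
Proof. by []. Qed.

Lemma bopNE H K (S : 'B(H, K)) x : (- S) x = - S x.
Proof. by []. Qed.

Lemma bopZE H K a (S : 'B(H, K)) x : (a *: S) x = a *: S x.
Proof. by []. Qed.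

Lemma bop0E H K x : (0 : 'B(H, K)) x = 0.
Proof. by []. Qed.

Lemma bopD H K (T : 'B(H, K)) x y : T (x + y) = T x + T y.
Proof. exact: linearD. Qed.

Lemma bopB H K (T : 'B(H, K)) x y : T (x - y) = T x - T y.
Proof. exact: linearB. Qed.

Lemma bopZ H K (T : 'B(H, K)) a x : T (a *: x) = a *: T x.
Proof. exact: linearZ. Qed.

Lemma bop_compE H K L (F : 'B(H, K)) (G : 'B(L, H)) x : (F *o G) x = F (G x).
Proof. by []. Qed.

Lemma bop_ext H K (S T : 'B(H, K)) : (forall x, S x = T x) -> S = T.
Proof. by move=> e; apply/val_inj/funext. Qed.

Definition ripE := (ripDl, ripDr, ripNl, ripNr, ripZl, ripZr).

Lemma rip_ge0 H (x : H) : 0 <= rip x x.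
Proof. by rewrite -ler0c -sq_norm exprn_ge0. Qed.

Lemma rip0l H (x : H) : rip 0 x = 0.
Proof. by have := ripDl 0 0 x; rewrite addr0; lra. Qed.

Lemma rip_eq0 H (x : H) : rip x x = 0 -> x = 0.
Proof.
by move=> x0; apply/eqP; rewrite -normr_eq0 -sqrf_eq0 sq_norm x0.
Qed.

Lemma rip_inner H (x y : H) : '[x, y] = rip x y +i* rip x ('i%C *: y).
Proof. by rewrite ripir /rip; case: '[x, y]. Qed.

Lemma ripDD H (x y : H) : rip (x + y) (x + y) = rip x x + 2 * rip x y + rip y y.
Proof. by rewrite !ripE (ripC y x); lra. Qed.

Lemma ripBB H (x y : H) : rip (x - y) (x - y) = rip x x - 2 * rip x y + rip y y.
Proof. by rewrite !ripE (ripC y x); lra. Qed.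

Lemma rip_CS H (x y : H) : rip x y ^+ 2 <= rip x x * rip y y.
Proof.
have [y0|y0] := eqVneq (rip y y) 0.
  by rewrite (rip_eq0 y0) ripC !rip0l mulr0 expr0n.
have yp : 0 < rip y y by rewrite lt_def y0 rip_ge0.
have := rip_ge0 ((rip y y)%:C *: x - (rip x y)%:C *: y).
rewrite ripBB !ripE -(pmulr_rge0 _ yp) => h.
rewrite -subr_ge0 -(pmulr_rge0 _ (mulr_gt0 yp yp)).
apply: le_trans h _; rewrite le_eqVlt; apply/orP; left; apply/eqP; ring.
Qed.

Lemma ler_ripD H (x y : H) : rip (x + y) (x + y) <= 2 * rip x x + 2 * rip y y.
Proof. by have := rip_ge0 (x - y); rewrite ripBB ripDD; lra. Qed.

Lemma norm_lt H (x : H) (r : R) : 0 < r -> (`|x| < r%:C) = (rip x x < r ^+ 2).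
Proof.
move=> r0; have r0' : 0 <= r by exact: ltW.
rewrite -(ltr_pXn2r (n := 2))// ?nnegrE ?ler0c//.
by rewrite sq_norm -rmorphXn ltcR.
Qed.

Lemma norm_le H K (x : H) (y : K) (M : R) : 0 <= M ->
  (`|x| <= M%:C * `|y|) = (rip x x <= M ^+ 2 * rip y y).
Proof.
move=> r0; rewrite -(ler_pXn2r (n := 2))// ?nnegrE ?mulr_ge0 ?ler0c//.
by rewrite exprMn !sq_norm -rmorphXn -rmorphM lecR.
Qed.

Lemma bop_rip_bound H K (T : 'B(H, K)) :
  exists2 C : R, 0 < C & forall x, rip (T x) (T x) <= C * rip x x.
Proof.
(* The summand 1 makes the constant strictly positive, so that it can be inverted. *)
have [M M0 TM] := bop_bounded_ge0 T; exists (M ^+ 2 + 1).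
  by rewrite ltr_wpDl// sqr_ge0.
move=> x; have := TM x; rewrite norm_le// => /le_trans; apply.
by rewrite ler_wpM2r ?rip_ge0// lerDl.
Qed.

Lemma rip_bounded H K (f : H -> K) (C : R) : linear f -> 0 <= C ->
  (forall x, rip (f x) (f x) <= C * rip x x) -> f \in @bounded_linear R H K.
Proof.
move=> lf C0 fC; apply/asboolP; split => //; exists (Num.sqrt C) => x.
by rewrite norm_le ?sqrtr_ge0// sqr_sqrtr.
Qed.

(** * Limits with explicit rates *)

Lemma archi_eq0 (a C : R) : 0 <= a -> (forall n, a * n%:R <= C) -> a = 0.
Proof.
move=> a0 h; apply/eqP; rewrite eq_le a0 andbT leNgt; apply/negP => a1.
have C0 : 0 <= C by have := h 0; rewrite mulr0.
have := archi_boundP (divr_ge0 C0 a0).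
by rewrite ltr_pdivrMr// mulrC ltNge h.
Qed.

Lemma archi_le0 (a C : R) : (forall n, a <= C / n.+1%:R) -> a <= 0.
Proof.
move=> h; rewrite leNgt; apply/negP => a0.
suff : a = 0 by move: a0 => /[swap] ->; rewrite ltxx.
apply: (@archi_eq0 _ C) => [|[|n]]; first exact: ltW.
  by rewrite mulr0; have := h 0; rewrite divr1; apply: le_trans; exact: ltW.
by rewrite -ler_pdivlMr.
Qed.

(** The factor 2 comes from [|u n - l|^2 <= 2 |u n - u m|^2 + 2 |u m - l|^2], where [m] is taken so
    large that the last term is below an arbitrary [e]. *)
Lemma complete_rate H (u : nat -> H) (C : R) :
  (forall n m, (n <= m)%N -> rip (u m - u n) (u m - u n) <= C / n.+1%:R) ->
  exists l, forall n, rip (u n - l) (u n - l) <= 2 * C / n.+1%:R.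
Proof.
move=> uC.
have C0 : 0 <= C.
  by have := uC 0 0 isT; rewrite divr1; apply: le_trans; exact: rip_ge0.
have small (e : R) : 0 < e -> exists n : nat, C / n.+1%:R < e.
  move=> e0; have [//|/forallNP h] := pselect (exists n : nat, C / n.+1%:R < e).
  suff : e <= 0 by rewrite leNgt e0.
  by apply: (archi_le0 (C := C)) => n; rewrite leNgt; apply/negP.
have norm_sym (x y : H) : rip (x - y) (x - y) = rip (y - x) (y - x).
  by rewrite !ripBB ripC; lra.
have /cvg_ex[l /cvgrPdist_lt ul] : cvg (u @ \oo).
  apply: cauchy_cvg; apply: cauchy_exP => e e0.
  have /complex_realP[r er] : e \is Num.real by rewrite gtr0_real.
  have r0 : 0 < r by rewrite -ltcR -er.
  have [n Cn] := small (r ^+ 2) (exprn_gt0 _ r0).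
  exists (u n); exists n => // m /= nm; rewrite -ball_normE /= er norm_lt//.
  by rewrite norm_sym; exact: le_lt_trans (uC _ _ nm) Cn.
exists l => n; apply/ler_addgt0Pr; suff le_e (e : R) : 0 < e ->
  rip (u n - l) (u n - l) <= 2 * C / n.+1%:R + e by exact: le_e.
move=> e0.
have s0 : 0 < Num.sqrt (e / 2) by rewrite sqrtr_gt0 divr_gt0.
have [|N _ uN] := ul (Num.sqrt (e / 2))%:C; first by rewrite ltcR.
set m := maxn N n.
have um : rip (l - u m) (l - u m) < e / 2.
  have := uN m (leq_maxl N n); rewrite /= norm_lt// sqr_sqrtr//.
  by rewrite divr_ge0// ltW.
have := uC _ _ (leq_maxr N n); rewrite -/m.
have := ler_ripD (u n - u m) (u m - l).
rewrite addrA subrK (norm_sym (u n) (u m)) (norm_sym (u m) l).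
by move: um; rewrite -[2 * C / _]mulrA; move: (C / _) => c; lra.
Qed.

(** * Riesz representation and adjoints *)

Lemma idop_subproof H : (fun x : H => x) \in @bounded_linear R H H.
Proof.
by apply: (@rip_bounded _ _ _ 1) => // x; rewrite mul1r.
Qed.

Definition idop H : 'B(H, H) := Bop (idop_subproof H).

(* The double orthogonal complement of the range, that is, its closure. *)
Definition range_biperp H K (T : 'B(H, K)) (z : K) :=
  forall k, (forall v, '[T v, k] = 0) -> '[z, k] = 0.

Lemma inner_Zr H (x y : H) a : '[x, a *: y] = Num.conj a * '[x, y].
Proof. by rewrite linearZr_LR. Qed.

Lemma inner_Zl H (x y : H) a : '[a *: x, y] = a * '[x, y].
Proof. by rewrite linearZl_LR. Qed.

Lemma inner_Dl H (x y z : H) : '[x + y, z] = '[x, z] + '[y, z].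
Proof. by rewrite linearDl. Qed.

Lemma inner_Dr H (x y z : H) : '[z, x + y] = '[z, x] + '[z, y].
Proof. by rewrite linearDr. Qed.

Lemma inner_Br H (x y z : H) : '[z, x - y] = '[z, x] - '[z, y].
Proof. by rewrite -scaleN1r inner_Dr inner_Zr rmorphN1 mulN1r. Qed.

Lemma inner_eq_of_rip H K L (S : 'B(H, K)) (T : 'B(H, L)) y z :
  (forall v, rip (S v) y = rip (T v) z) -> forall v, '[S v, y] = '[T v, z].
Proof.
move=> h v.
(* The hypothesis at [conj i * v] gives the imaginary parts. *)
have hi : rip (S v) ('i%C *: y) = rip (T v) ('i%C *: z).
  have := h (Num.conj 'i%C *: v); rewrite !bopZ /rip !inner_Zl -!inner_Zr.
  exact.
by rewrite !rip_inner h hi.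
Qed.

Lemma discr_le (a c s : R) : 0 <= s ->
  (forall t, 0 <= c + 2 * t * a + t ^+ 2 * s) -> a ^+ 2 <= c * s.
Proof.
move=> s0 h; have [s0'|s0'] := eqVneq s 0.
  have [->|a0] := eqVneq a 0; first by rewrite s0' mulr0 expr0n.
  (* For [s = 0] the polynomial is affine in [t], and this [t] gives it the value -1. *)
  have := h (- (c + 1) / (2 * a)); rewrite s0' mulr0 addr0.
  have -> : c + 2 * (- (c + 1) / (2 * a)) * a = - 1 by field.
  lra.
have sp : 0 < s by rewrite lt_def s0'.
have := mulr_ge0 s0 (h (- a / s)).
have -> : s * (c + 2 * (- a / s) * a + (- a / s) ^+ 2 * s) = c * s - a ^+ 2.
  by field.
by rewrite subr_ge0.
Qed.

(* The images under T of a sequence minimizing |T v|^2 - 2 f v are Cauchy by the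
   parallelogram identity, and z is their limit. *)
Lemma riesz_range H K (T : 'B(H, K)) (f : H -> R) (C : R) :
  (forall u v, f (u + v) = f u + f v) ->
  (forall r u, f (r%:C *: u) = r * f u) ->
  0 <= C -> (forall v, f v ^+ 2 <= C * rip (T v) (T v)) ->
  exists z, [/\ forall v, f v = rip (T v) z, range_biperp T z & rip z z <= C].
Proof.
move=> fD fZ C0 fC.
pose J v := rip (T v) (T v) - 2 * f v.
(* By the arithmetic-geometric inequality, [2 f v <= 2 sqrt (C |T v|^2) <= C + |T v|^2]. *)
have J_ge v : - C <= J v.
  rewrite /J; have := fC v; have := rip_ge0 (T v).
  move: (rip _ _) (f v) => s t s0 h.
  have := sqr_ge0 (s - C); rewrite leNgt => sC; apply/negP => lt; nra.
pose E := [set J v | v in setT].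
have Ei : has_inf E.
  split; first by exists (J 0); exists 0.
  by exists (- C) => _ [v _ <-].
have [m m_le m_inf] : exists2 m : R, (forall v, m <= J v) &
    forall e : R, 0 < e -> exists v, J v < m + e.
  exists (inf E) => [v|e e0]; first by apply: ge_inf; [case: Ei|exists v].
  by have [_ [v _ <-] h] := inf_adherent e0 Ei; exists v.
have /choice[u uJ] (n : nat) : exists v, J v < m + n.+1%:R^-1.
  by apply: m_inf; rewrite invr_gt0.
have par v w : rip (T v - T w) (T v - T w) <= 2 * (J v + J w - 2 * m).
  have := m_le ((2^-1)%:C *: (v + w)).
  rewrite /J bopZ bopD fZ fD ripBB !ripE (ripC (T w) (T v)).
  lra.
have [n k nk|z zu] := @complete_rate _ (T \o u) 4.
  have := par (u k) (u n); have := uJ n; have := uJ k.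
  have : k.+1%:R^-1 <= n.+1%:R^-1 :> R.
    by rewrite lef_pV2 ?posrE ?ltr0n// ler_nat.
  move: (rip _ _) (J _) (J _) (_^-1) (_^-1) => /= a b c d e h1 h2 h3 h4; lra.
(* Approximate stationarity: [J (u n + t v) >= m > J (u n) - 1/(n+1)] for all real [t], so the
   discriminant in [t] is bounded. *)
have Tu v n : (rip (T (u n)) (T v) - f v) ^+ 2 <= n.+1%:R^-1 * rip (T v) (T v).
  apply: discr_le => [|t]; first exact: rip_ge0.
  have := m_le (u n + t%:C *: v); have := uJ n.
  rewrite /J bopD bopZ fD fZ ripDD !ripE expr2.
  by move: (_^-1) => d h1 h2; lra.
have fE v : f v = rip (T v) z.
  suff h : (rip z (T v) - f v) ^+ 2 <= 0.
    apply/esym/eqP; rewrite -subr_eq0 -sqrf_eq0 eq_le sqr_ge0 andbT.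
    by rewrite ripC.
  (* 18 = 2 (8 + 1): 8 from the rate [zu], 1 from [Tu]. *)
  apply: (archi_le0 (C := 18 * rip (T v) (T v))) => n.
  have := Tu v n; have := rip_CS (T (u n) - z) (T v).
  have := ler_wpM2r (rip_ge0 (T v)) (zu n).
  rewrite /= (ripDl _ _ (T v)) ripNl.
  move: (_^-1) (rip (_ - _) _) (rip (T (u n)) _) (rip z _) => d a b c h1 h2 h3.
  have := sqr_ge0 (b + b - f v - c); lra.
exists z; split => [//|k Tk|].
- have rk0 y : (forall v, '[T v, y] = 0) -> rip z y = 0.
    move=> Ty; apply/eqP; rewrite -sqrf_eq0 eq_le sqr_ge0 andbT.
    apply: (archi_le0 (C := 8 * rip y y)) => n.
    have := rip_CS (T (u n) - z) y; rewrite ripDl ripNl {1}/rip Ty sub0r sqrrN.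
    move=> /le_trans; apply; rewrite mulrAC ler_wpM2r ?rip_ge0//.
    by apply: le_trans (zu n) _; rewrite -natrM.
  by rewrite rip_inner !rk0// => v; rewrite inner_Zr Tk mulr0.
(* Now that [z] represents [f], [|T (u n) - z|^2 = J (u n) + |z|^2 >= |z|^2 - C], and the left side
   tends to 0. *)
- suff : rip z z - C <= 0 by rewrite subr_le0.
  apply: (archi_le0 (C := 8)) => n.
  have := J_ge (u n); have := zu n; rewrite /J/= ripBB -fE.
  by move: (_^-1) => d h1 h2; lra.
Qed.

(** Uniqueness principle: vectors of the closed range are determined by their inner products with
    the range itself. *)
Lemma range_biperp_inner H K (T : 'B(H, K)) z :
  range_biperp T z -> (forall v, '[T v, z] = 0) -> z = 0.
Proof.
by move=> /[apply] zz; apply: rip_eq0; rewrite /rip zz.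
Qed.

Lemma range_biperp_lin H K (T : 'B(H, K)) a x y :
  range_biperp T x -> range_biperp T y -> range_biperp T (a *: x + y).
Proof.
by move=> hx hy k Tk; rewrite inner_Dl inner_Zl hx// hy// mulr0 addr0.
Qed.

Lemma range_biperp_img H K (T : 'B(H, K)) v : range_biperp T (T v).
Proof. by move=> k. Qed.

(* G is the adjoint of the operator W such that S = W T and W vanishes on the
   orthogonal complement of the range of T. For T = 1 this is the existence of
   the adjoint of S. *)
Lemma factor_adjoint H K L (T : 'B(H, K)) (S : 'B(H, L)) (C : R) :
  0 <= C -> (forall v, rip (S v) (S v) <= C * rip (T v) (T v)) ->
  exists G : 'B(L, K), [/\ forall v y, '[S v, y] = '[T v, G y],
    forall y, range_biperp T (G y) & forall y, rip (G y) (G y) <= C * rip y y].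
Proof.
move=> C0 SC.
have /choice[g gP] y : exists z, [/\ forall v, '[S v, y] = '[T v, z],
    range_biperp T z & rip z z <= C * rip y y].
  have [|r u|||z [z1 z2 z3]] :=
    @riesz_range H K T (fun v => rip (S v) y) (C * rip y y).
  - by move=> u v; rewrite bopD ripDl.
  - by rewrite bopZ ripZl.
  - by rewrite mulr_ge0// rip_ge0.
  - move=> v; apply: le_trans (rip_CS _ _) _.
    by rewrite mulrAC ler_wpM2r ?rip_ge0.
  - by exists z; split => //; apply: inner_eq_of_rip.
have lg : linear g.
  move=> a x y; have [x1 x2 _] := gP x; have [y1 y2 _] := gP y.
  have [xy1 xy2 _] := gP (a *: x + y).
  apply/eqP; rewrite -subr_eq0; apply/eqP; apply: (range_biperp_inner (T := T)).
    have -> : g (a *: x + y) - (a *: g x + g y) =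
        -1 *: (a *: g x + g y) + g (a *: x + y).
      by rewrite scaleN1r addrC.
    by apply: range_biperp_lin => //; exact: range_biperp_lin.
  move=> v; rewrite -scaleN1r inner_Dr !inner_Zr inner_Dr inner_Zr -xy1 -x1 -y1.
  by rewrite inner_Dr inner_Zr rmorphN1 mulN1r subrr.
have gb : g \in @bounded_linear R L K.
  by apply: (rip_bounded lg C0) => y; have [] := gP y.
by exists (Bop gb); split => [v y|y|y]; have [] := gP y.
Qed.

Lemma adjointP H K (T : 'B(H, K)) x y : '[T x, y] = '[x, adjoint T y].
Proof.
have [C /ltW C0 TC] := bop_rip_bound T.
have [G [GT _ _]] := @factor_adjoint H H K (idop H) T C C0 TC.
by have := @xgetPex _ 0 [set S : 'B(K, H) | forall x y, '[T x, y] = '[x, S y]]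
  (ex_intro _ G GT) x y.
Qed.

Lemma rip_adjoint H K (T : 'B(H, K)) x y : rip (T x) y = rip x (adjoint T y).
Proof. by rewrite /rip adjointP. Qed.

Lemma rip_injr H (y z : H) : (forall x, rip x y = rip x z) -> y = z.
Proof.
move=> h; apply/eqP; rewrite -subr_eq0; apply/eqP/rip_eq0.
by rewrite ripDr ripNr h subrr.
Qed.

Lemma adjoint_unique H K (T : 'B(H, K)) (S : 'B(K, H)) :
  (forall x y, rip (T x) y = rip x (S y)) -> adjoint T = S.
Proof.
move=> h; apply: bop_ext => y; apply: rip_injr => x.
by rewrite -rip_adjoint h.
Qed.

(** * Positive operators and limits of operator sequences *)

Lemma scaleii H (x : H) : 'i%C *: ('i%C *: x) = - x.
Proof. by rewrite scalerA -expr2 sqr_i scaleN1r. Qed.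

Lemma rip_ii H (x y : H) : rip ('i%C *: x) ('i%C *: y) = rip x y.
Proof. by rewrite /rip inner_Zl inner_Zr; case: '[x, y] => a b /=; ring. Qed.

(** Polarization: the imaginary part of ['[P z, z]] vanishes at [i x + y], [i x] and [y], which
    leaves the cross terms. *)
Lemma positive_op_sym H (P : 'B(H, H)) :
  positive_op P -> forall x y, rip (P x) y = rip x (P y).
Proof.
move=> P0 x y.
have im (z : H) : rip (P z) ('i%C *: z) = 0.
  by rewrite ripir; have := P0 z; rewrite lecE => /andP[/eqP].
have := im ('i%C *: x + y); have := im y; have := im ('i%C *: x).
rewrite bopD bopZ scalerDr scaleii !ripE !rip_ii.
by rewrite (ripC x) => h1 h2 h3; lra.
Qed.

(** Symmetry for the real form makes [rip (P x) (i x)] equal to its own opposite, so ['[P x, x]] is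
    real. *)
Lemma positive_opP H (P : 'B(H, H)) :
  (forall x y, rip (P x) y = rip x (P y)) -> (forall x, 0 <= rip (P x) x) ->
  positive_op P.
Proof.
move=> Ps P0 x; rewrite lecE; apply/andP; split; last exact: P0.
rewrite -ripir; apply/eqP.
have := Ps x ('i%C *: x).
by rewrite bopZ -[rip x _]rip_ii scaleii ripNr (ripC _ (P x)) /=; lra.
Qed.

Lemma positive_op_rip_ge0 H (P : 'B(H, H)) x : positive_op P -> 0 <= rip (P x) x.
Proof. by move/(_ x); rewrite lecE => /andP[]. Qed.

Lemma real2c : 2%:C = 2 :> R[i].
Proof. by rewrite -[2]/(1 + 1) rmorphD rmorph1. Qed.

Lemma scale2c H (x : H) : 2%:C *: x = x + x.
Proof. by rewrite real2c -[2]/(1 + 1) scalerDl scale1r. Qed.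

Lemma rip_lim0 H (w : H) (D : R) : (forall n, rip w w <= D / n.+1%:R) -> w = 0.
Proof.
by move=> /archi_le0 h; apply/rip_eq0/eqP; rewrite eq_le h rip_ge0.
Qed.

Lemma rip_scale H (a : R[i]) : exists2 k : R, 0 <= k &
  forall x : H, rip (a *: x) (a *: x) = k * rip x x.
Proof.
have /complex_realP[r ar] := normr_real a.
exists (r ^+ 2) => [|x]; first exact: sqr_ge0.
apply: complexI.
by rewrite -sq_norm normrZ exprMn ar rmorphM rmorphXn /= sq_norm.
Qed.

Lemma bop_complete H K (F : nat -> 'B(H, K)) (B : R) :
  (forall n m x, (n <= m)%N ->
     rip (F m x - F n x) (F m x - F n x) <= B * rip x x / n.+1%:R) ->
  exists G : 'B(H, K), forall n x,
     rip (F n x - G x) (F n x - G x) <= 2 * (B * rip x x) / n.+1%:R.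
Proof.
move=> FB.
have /choice[g gF] x : exists l, forall n,
    rip (F n x - l) (F n x - l) <= 2 * (B * rip x x) / n.+1%:R.
  by apply: (complete_rate (u := fun n => F n x)) => n m; exact: FB.
have lg : linear g.
  move=> a x y; apply/eqP; rewrite -subr_eq0; apply/eqP.
  have [k k0 ka] := rip_scale K a.
  (* The defect of linearity is [- r + (p + q)] with [p], [q], [r] approximation errors; [ler_ripD]
     used twice gives the weights 2, 4, 4, which the rate doubles. *)
  apply: (@rip_lim0 _ _ (4 * (B * rip (a *: x + y) (a *: x + y)) +
    8 * (B * rip x x) * k + 8 * (B * rip y y))) => n.
  have := gF (a *: x + y) n; have := ler_wpM2l k0 (gF x n); have := gF y n.
  rewrite -(ka (F n x - g x)).
  set p := a *: (F n x - g x); set q := F n y - g y.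
  set r := F n (a *: x + y) - g (a *: x + y).
  have -> : g (a *: x + y) - (a *: g x + g y) = - r + (p + q).
    rewrite /r /p /q bopD bopZ scalerBr opprB.
    by rewrite [X in _ = _ + X]addrACA -opprD addrA subrK.
  have := ler_ripD (- r) (p + q); have := ler_ripD p q.
  rewrite ripNl ripNr opprK.
  move: (rip r r) (rip _ _) (rip _ _) (rip q q) (rip p p).
  by move: (_^-1) => d *; lra.
have [C C0 FC] := bop_rip_bound (F 0).
have gb : g \in @bounded_linear R H K.
  (* [g x] is compared with [F 0 x]; the absolute value is there because the sign of [B] is
     unknown. *)
  apply: (@rip_bounded _ _ _ (2 * C + 4 * `|B|)) => // [|x].
    by rewrite addr_ge0 ?mulr_ge0// ltW.
  have := ler_ripD (F 0 x - g x) (- F 0 x); rewrite addrAC subrr sub0r.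
  rewrite !ripNl !ripNr !opprK.
  have := gF x 0; have := FC x; rewrite divr1.
  have := ler_wpM2r (rip_ge0 x) (ler_norm B).
  move: (rip (g x) _) (rip (_ - _) _) (rip (F 0 x) _) => *; lra.
by exists (Bop gb).
Qed.

(** * Square roots by successive approximation *)

Lemma bop_comp_sqrB H (F G : 'B(H, H)) :
  F *o F - G *o G = F *o (F - G) + (F - G) *o G.
Proof.
apply: bop_ext => x; rewrite !(bopDE, bopNE) !bop_compE !(bopDE, bopNE) bopB.
by rewrite addrA subrK.
Qed.

Definition opnorm_le H K (F : 'B(H, K)) (a : R) :=
  forall x, `|F x| <= a%:C * `|x|.

Lemma opnorm_leD H K (F G : 'B(H, K)) a b :
  opnorm_le F a -> opnorm_le G b -> opnorm_le (F + G) (a + b).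
Proof.
move=> Fa Gb x; rewrite bopDE (le_trans (ler_normD _ _))//.
by rewrite rmorphD mulrDl lerD.
Qed.

Lemma opnorm_leM H K L (F : 'B(H, K)) (G : 'B(L, H)) a b : 0 <= a ->
  opnorm_le F a -> opnorm_le G b -> opnorm_le (F *o G) (a * b).
Proof.
move=> a0 Fa Gb x; rewrite (le_trans (Fa _))// rmorphM/= -mulrA.
by rewrite ler_wpM2l// lecR.
Qed.

Lemma opnorm_leZ H K (F : 'B(H, K)) a b : 0 <= a ->
  opnorm_le F b -> opnorm_le (a%:C *: F) (a * b).
Proof.
move=> a0 Fa x; rewrite bopZE normrZ rmorphM /= -mulrA ger0_norm ?lecR//.
by rewrite ler_wpM2l// lecR.
Qed.

Section Sqrt.
Variables (H : hilbertType R) (S : 'B(H, H)).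
Hypothesis S1 : opnorm_le S 1.

(* The limit Y satisfies 2 Y = S + Y^2, that is, (1 - Y)^2 = 1 - S. *)
Fixpoint sqrt_seq n : 'B(H, H) :=
  if n is n'.+1 then (2^-1)%:C *: (S + sqrt_seq n' *o sqrt_seq n') else 0.

(* The case S = 1: since the recursion has nonnegative coefficients, the
   increments of this sequence dominate those of sqrt_seq in norm. *)
Fixpoint sqrt_rseq n : R :=
  if n is n'.+1 then 2^-1 * (1 + sqrt_rseq n' * sqrt_rseq n') else 0.

Local Notation Y := sqrt_seq.
Local Notation y := sqrt_rseq.

Lemma sqrt_seqS n : Y n.+1 = (2^-1)%:C *: (S + Y n *o Y n).
Proof. by []. Qed.

Lemma sqrt_rseq_bound n : 0 <= y n <= 1 /\ (1 - y n) * n.+2%:R <= 2.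
Proof.
elim: n => [|n [/andP[y0 y1] yn]]; first by rewrite lexx ler01; split=> //=; lra.
have n0 : 0 <= n%:R :> R by [].
rewrite -!natr1 in yn *; rewrite /= -/(sqrt_rseq n).
move: (y n) (n%:R) y0 y1 yn n0 => t N t0 t1 tN N0.
split; first by apply/andP; split; nra.
have tN' : 0 <= 2 - (1 - t) * (N + 2) by lra.
have t2 : 0 <= 1 - (1 - t) / 2 by lra.
have := mulr_ge0 tN' t2; have := sqr_ge0 (1 - t); lra.
Qed.

Lemma sqrt_seq_bound n : opnorm_le (Y n) (y n).
Proof.
elim: n => [|n IH] /=; first by move=> x; rewrite bop0E normr0 mul0r.
apply: opnorm_leZ; first by rewrite invr_ge0.
apply: opnorm_leD S1 _; apply: opnorm_leM => //.
by have [/andP[]] := sqrt_rseq_bound n.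
Qed.

Lemma sqrt_seq_diff n : opnorm_le (Y n.+1 - Y n) (y n.+1 - y n).
Proof.
elim: n => [|n IH].
  rewrite !subr0; exact: (sqrt_seq_bound 1).
(* Half a difference of squares, factored without commuting the operators; the scalar increments
   factor in the same way. *)
have -> : Y n.+2 - Y n.+1 = (2^-1)%:C *:
  (Y n.+1 *o (Y n.+1 - Y n) + (Y n.+1 - Y n) *o Y n).
  rewrite -bop_comp_sqrB {1}sqrt_seqS (sqrt_seqS n) -scalerBr opprD.
  by rewrite addrACA subrr add0r.
have -> : y n.+2 - y n.+1 =
    2^-1 * (y n.+1 * (y n.+1 - y n) + (y n.+1 - y n) * y n).
  rewrite -[y n.+2]/(_ * (1 + y n.+1 * y n.+1)).
  by rewrite -{3}[y n.+1]/(_ * (1 + y n * y n)); ring.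
have [/andP[y0 _] _] := sqrt_rseq_bound n.
have [/andP[y1 _] _] := sqrt_rseq_bound n.+1.
apply: opnorm_leZ; first by rewrite invr_ge0.
apply: opnorm_leD; apply: opnorm_leM => //; try exact: sqrt_seq_bound.
have := sqr_ge0 (1 - y n); rewrite /= -/(sqrt_rseq n); lra.
Qed.

Lemma sqrt_rseq_le n m : (n <= m)%N -> y n <= y m.
Proof.
move=> /subnK <-; elim: (m - n)%N => // k IH; apply: le_trans IH _.
rewrite addSn.
have := sqr_ge0 (1 - y (k + n)); rewrite /= -/(sqrt_rseq _); lra.
Qed.

Lemma sqrt_seq_diffs n m : (n <= m)%N -> opnorm_le (Y m - Y n) (y m - y n).
Proof.
move=> /subnK <-; elim: (m - n)%N => [|k IH].
  by rewrite !subrr => x; rewrite bop0E normr0 mul0r.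
have := opnorm_leD (sqrt_seq_diff (k + n)) IH.
by rewrite !addrA !subrK.
Qed.

Lemma sqrt_seq_rate n m x : (n <= m)%N ->
  rip (Y m x - Y n x) (Y m x - Y n x) <= 2 * rip x x / n.+1%:R.
Proof.
move=> nm; have := sqrt_seq_diffs nm x.
rewrite norm_le ?subr_ge0 ?sqrt_rseq_le// => /le_trans; apply.
rewrite [leRHS]mulrAC ler_wpM2r ?rip_ge0// ler_pdivlMr ?ltr0n//.
have := sqrt_rseq_le nm; have [/andP[y0 y1] yn] := sqrt_rseq_bound n.
have [/andP[z0 z1] _] := sqrt_rseq_bound m => yz.
rewrite -natr1 in yn.
have N0 : 0 <= n.+1%:R :> R by [].
move: (y n) (y m) n.+1%:R y0 y1 yn z0 z1 yz N0 => t s N t0 t1 yn s0 s1 ts N0.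
(* From [0 <= t <= s <= 1] follows [(s - t)^2 <= s - t <= 1 - t]. *)
apply: (@le_trans _ _ ((1 - t) * N)); last by lra.
by rewrite ler_wpM2r// expr2; nra.
Qed.

Hypothesis S_sym : forall x z, rip (S x) z = rip x (S z).

Lemma sqrt_seq_sym n x z : rip (Y n x) z = rip x (Y n z).
Proof.
elim: n x z => [|n IH] x z; first by rewrite !bop0E [RHS]ripC !rip0l.
by rewrite sqrt_seqS !bopZE !bopDE !bop_compE !ripE S_sym !IH.
Qed.

Lemma sqrt_seq_rip n x : rip (Y n x) (Y n x) <= rip x x.
Proof.
have := sqrt_seq_bound n x; have [/andP[y0 y1] _] := sqrt_rseq_bound n.
rewrite norm_le// => /le_trans; apply.
by rewrite -[leRHS]mul1r ler_wpM2r ?rip_ge0// expr_le1.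
Qed.

Lemma sqrt_limit : exists G : 'B(H, H),
  [/\ forall x z, rip (G x) z = rip x (G z), forall x, rip (G x) x <= rip x x &
      G + G = S + G *o G].
Proof.
have [n m x nm|G GY] := @bop_complete H H Y 2; first exact: sqrt_seq_rate.
have dist n x z : rip (Y n x - G x) z ^+ 2 <= 4 * rip x x * rip z z / n.+1%:R.
  apply: le_trans (rip_CS _ _) _.
  have := ler_wpM2r (rip_ge0 z) (GY n x).
  by move: (rip (_ - _) _) (_^-1) => a b; lra.
exists G; split => [x z|x|].
- apply/eqP; rewrite -subr_eq0 -sqrf_eq0 eq_le sqr_ge0 andbT.
  apply: (archi_le0 (C := 16 * rip x x * rip z z)) => n.
  have := dist n x z; have := dist n z x; rewrite !ripDl !ripNl.
  rewrite (sqrt_seq_sym n x) (ripC (Y n z)) (ripC (G z)) => /=.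
  move: (rip x (Y n z)) (rip (G x) z) (rip x (G z)) (_^-1) => a b c d h1 h2.
  have := sqr_ge0 (a + a - b - c); lra.
(* Since [rip (Y n x) x <= rip x x < rip (G x) x], the gap to [rip x x] is at most the approximation
   error, which tends to 0. *)
- rewrite leNgt; apply/negP => xG.
  suff : (rip (G x) x - rip x x) ^+ 2 <= 0.
    by rewrite real_leNgt ?realE ?sqr_ge0 ?lexx// exprn_gt0 // subr_gt0.
  apply: (archi_le0 (C := 4 * rip x x * rip x x)) => n.
  have := dist n x x; apply: le_trans; rewrite ripDl ripNl.
  have : rip (Y n x) x <= rip x x.
    have := rip_ge0 (Y n x - x); rewrite ripBB; have := sqrt_seq_rip n x; lra.
  move: (rip (Y n x) x) (rip (G x) x) (rip x x) xG => a b c h1 h2; nra.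
apply: bop_ext => x; rewrite !bopDE bop_compE.
apply/eqP; rewrite -subr_eq0; apply/eqP.
apply: (@rip_lim0 _ _ (48 * rip x x + 16 * rip (G x) (G x))) => n.
have G1 := GY n.+1 x; have G2 := GY n x; have G3 := GY n (G x).
have Y1 := sqrt_seq_rip n (Y n x - G x).
(* Substituting [S = 2 Y_(n+1) - Y_n^2] writes the defect through approximation errors only; [Y n]
   is a contraction, so the middle term is controlled too. The weights 8, 4, 4 and the rate 4 give
   48 and 16. *)
have -> : G x + G x - (S x + G (G x)) =
  (2%:C *: - (Y n.+1 x - G x)) + (Y n (Y n x - G x) + (Y n (G x) - G (G x))).
  have -> : S x = Y n.+1 x + Y n.+1 x - Y n (Y n x).
    rewrite -scale2c sqrt_seqS bopZE scalerA -rmorphM divff ?pnatr_eq0// scale1r.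
    by rewrite bopDE bop_compE addrK.
  rewrite bopB [X in _ = _ + X]addrA subrK opprB scale2c.
  rewrite [X in _ = X + _]addrACA -opprD [X in _ + X = _]opprD.
  rewrite [X in _ + (X - _) = _]opprB.
  by rewrite [X in _ + X = _]addrAC [LHS]addrA addrAC.
have := ler_ripD (2%:C *: - (Y n.+1 x - G x))
  (Y n (Y n x - G x) + (Y n (G x) - G (G x))).
have := ler_ripD (Y n (Y n x - G x)) (Y n (G x) - G (G x)).
have : n.+2%:R^-1 <= n.+1%:R^-1 :> R.
  by rewrite lef_pV2 ?posrE ?ltr0n// ler_nat.
move: G1 G2 G3 Y1; rewrite ripZl ripZr ripNl ripNr opprK.
move: (rip (Y n.+1 x - G x) _) (rip (Y n x - G x) _) => a b.
move: (rip (Y n (Y n x - G x)) _) (rip (Y n (G x) - _) _) => c d.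
move: (rip (_ + _) _) (rip (_ + _) _) (rip_ge0 x) (rip_ge0 (G x)) => e f.
move: (rip x x) (rip (G x) (G x)) (_^-1) (_^-1) => X Z r r'.
move=> X0 Z0 h1 h2 h3 h4 h5 h6 h7; have := ler_wpM2l X0 h5; lra.
Qed.

End Sqrt.

(** * Existence and properties of the modulus *)

Lemma adjoint_bound H K (X : 'B(H, K)) (C : R) : 0 < C ->
  (forall x, rip (X x) (X x) <= C * rip x x) ->
  forall w, rip (adjoint X w) (adjoint X w) <= C * rip w w.
Proof.
(* Cauchy-Schwarz gives [|X^* w|^4 <= |X X^* w|^2 |w|^2 <= C |X^* w|^2 |w|^2]; a nonzero [|X^* w|^2]
   is cancelled. *)
move=> C0 XC w; have := rip_CS (X (adjoint X w)) w; rewrite rip_adjoint.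
have := ler_wpM2r (rip_ge0 w) (XC (adjoint X w)).
have := rip_ge0 (adjoint X w); rewrite le_eqVlt => /orP[/eqP<-|].
  by rewrite mulr_ge0 ?rip_ge0// ltW.
move=> p h1 h2; rewrite -(ler_pM2l p) -expr2.
by apply: le_trans h2 _; rewrite mulrCA mulrA.
Qed.

(** For [S = 1 - X^* X / C], the limit [G] satisfies [(1 - G)^2 = 1 - S], so [P = sqrt C (1 - G)]
    squares to [X^* X]. *)
Lemma sqrt_exists H K (X : 'B(H, K)) :
  exists P : 'B(H, H), positive_op P /\ P *o P = adjoint X *o X.
Proof.
have [C C0 XC] := bop_rip_bound X.
have adjX := adjoint_bound C0 XC.
have XX x z : rip (adjoint X (X x)) z = rip (X x) (X z).
  by rewrite ripC -rip_adjoint ripC.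
pose S : 'B(H, H) := idop H - (C^-1)%:C *: (adjoint X *o X).
have SE x : S x = x - (C^-1)%:C *: adjoint X (X x) by [].
have [||G [Gs G1 GE]] := @sqrt_limit H S.
(* With [c = 1/C], [|S x|^2 = |x|^2 - 2 c |X x|^2 + c^2 |X^* X x|^2], and the last term is at most
   [c |X x|^2]. *)
- move=> x; rewrite norm_le// expr1n mul1r SE ripBB !ripE.
  rewrite (ripC x (adjoint X _)) XX.
  have c0 : 0 < C^-1 by rewrite invr_gt0.
  have := ler_wpM2l (ltW c0) (adjX (X x)); rewrite mulKf ?gt_eqF//.
  rewrite -(ler_pM2l c0); have := mulr_ge0 (ltW c0) (rip_ge0 (X x)).
  by move: (C^-1) (rip _ _) (rip _ _) (rip _ _) => c *; lra.
- by move=> x z; rewrite !SE !ripE XX (ripC x (adjoint X _)) XX (ripC (X z)).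
exists ((Num.sqrt C)%:C *: (idop H - G)); split.
  apply: positive_opP => [x z|x].
    by rewrite !bopZE !bopDE !bopNE !ripE Gs.
  rewrite bopZE ripZl mulr_ge0 ?sqrtr_ge0// bopDE bopNE ripDl ripNl subr_ge0.
  exact: G1.
apply: bop_ext => x; rewrite !bop_compE.
have GxE : G x + G x = S x + G (G x) by rewrite -[RHS]/((S + G *o G) x) -GE.
have PE z : (idop H - G) z = z - G z by [].
rewrite !bopZE bopZ scalerA -rmorphM -expr2 sqr_sqrtr ?(ltW C0)// !PE bopB.
have -> : x - G x - (G x - G (G x)) = C^-1%:C *: adjoint X (X x).
  rewrite opprB addrA addrAC -[x - G x - G x]addrA -opprD GxE opprD addrA subrK.
  by rewrite SE opprB addrC subrK.
by rewrite scalerA -rmorphM divff ?gt_eqF// scale1r.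
Qed.

Lemma op_sqrtP H (T P0 : 'B(H, H)) : positive_op P0 -> P0 *o P0 = T ->
  positive_op (op_sqrt T) /\ op_sqrt T *o op_sqrt T = T.
Proof.
move=> p0 PT.
exact: (@xgetPex _ 0 [set S : 'B(H, H) | positive_op S /\ S *o S = T]
  (ex_intro _ P0 (conj p0 PT))).
Qed.

Lemma op_absP H K (X : 'B(H, K)) :
  positive_op (op_abs X) /\ op_abs X *o op_abs X = adjoint X *o X.
Proof. have [P [P0 PX]] := sqrt_exists X; exact: op_sqrtP P0 PX. Qed.

Lemma op_abs_sym H K (X : 'B(H, K)) u v :
  rip (op_abs X u) v = rip u (op_abs X v).
Proof. by apply: positive_op_sym; case: (op_absP X). Qed.

Lemma op_abs_rip H K (X : 'B(H, K)) u v :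
  rip (op_abs X u) (op_abs X v) = rip (X u) (X v).
Proof.
rewrite op_abs_sym -bop_compE (op_absP X).2 bop_compE.
by rewrite -rip_adjoint.
Qed.

(** * The lifting and the qsym modulus *)

Lemma hsum_rip H K (x y : hsum H K) : rip x y = rip x.1 y.1 + rip x.2 y.2.
Proof. by rewrite /rip /= /hsum_inner; case: '[_, _]; case: '[_, _]. Qed.

Lemma adjointK H K (T : 'B(H, K)) : adjoint (adjoint T) = T.
Proof. by apply: adjoint_unique => x y; rewrite ripC -rip_adjoint ripC. Qed.

Lemma adjointD H K (S T : 'B(H, K)) : adjoint (S + T) = adjoint S + adjoint T.
Proof.
by apply: adjoint_unique => x y; rewrite !bopDE ripDl ripDr !rip_adjoint.
Qed.

Lemma liftingD H (S T : 'B(H, H)) : lifting (S + T) = lifting S + lifting T.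
Proof.
by rewrite /lifting -scalerDr adjointD; congr (_ *: _); exact: bop_ext.
Qed.

Lemma adjoint_lifting H (T : 'B(H, H)) :
  adjoint (lifting T) *o lifting T =
  2^-1 *: (adjoint T *o T + T *o adjoint T).
Proof.
apply: bop_ext => x; apply: rip_injr => z.
(* The scalars are turned into embedded reals so that the rules for [rip] apply. *)
have sE : (sqrtC 2)^-1 = (Num.sqrt 2)^-1%:C :> R[i].
  have <- : (Num.sqrt 2)%:C ^+ 2 = 2 :> R[i].
    by rewrite -rmorphXn /= sqr_sqrtr// real2c.
  by rewrite sqrCK ?fmorphV// ler0c sqrtr_ge0.
have hE : 2^-1 = (2^-1)%:C :> R[i] by rewrite fmorphV /= real2c.
have LE v : lifting T v =
    ((Num.sqrt 2)^-1%:C *: T v, (Num.sqrt 2)^-1%:C *: adjoint T v).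
  by rewrite /lifting sE.
have s2 : (Num.sqrt 2)^-1 * (Num.sqrt 2)^-1 = 2^-1 :> R.
  by rewrite -invfM -expr2 sqr_sqrtr.
rewrite bop_compE -rip_adjoint hsum_rip !LE hE bopZE bopDE !bop_compE /= !ripE.
rewrite !mulrA s2 mulrDr; congr (_ * _ + _ * _); first by rewrite -rip_adjoint.
by rewrite [RHS]ripC [RHS]rip_adjoint ripC.
Qed.

Lemma op_qsymE H (T : 'B(H, H)) : op_qsym T = op_abs (lifting T).
Proof. by rewrite /op_abs adjoint_lifting. Qed.

(** * Equality in the triangle inequality *)

Lemma monotone_drift_eq0 H (P Q E : 'B(H, H)) :
  positive_op P -> positive_op Q ->
  (forall v, 2 * rip (P v) (E v) + rip (E v) (E v) <= 0) ->
  (forall v, rip (E v) (E v) <= 2 * rip (Q v) (E v)) ->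
  E = 0.
Proof.
move=> P0 Q0 PE QE.
have [C C0 PC] := bop_rip_bound P; have [D D0 QD] := bop_rip_bound Q.
have bnd (F : 'B(H, H)) B v : rip (F v) (F v) <= B * rip v v ->
    rip (F v) v <= (1 + B) * rip v v.
  have := rip_ge0 (F v - v); have := rip_ge0 (F v); have := rip_ge0 v.
  rewrite ripBB => h1 h2 h3 h4; lra.
pose M := 1 + C + D.
have M1 : 1 <= M by rewrite /M; lra.
have PM v : rip (P v) v <= M * rip v v.
  apply: le_trans (bnd _ _ _ (PC v)) _; rewrite ler_wpM2r ?rip_ge0// /M; lra.
have QM v : rip (Q v) v <= M * rip v v.
  apply: le_trans (bnd _ _ _ (QD v)) _; rewrite ler_wpM2r ?rip_ge0// /M; lra.
clearbody M.
(* With [e M = 1/2], the second-order term [e^2 '[P (E v), E v]] uses up at most half of the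
   first-order drop [e |E v|^2]. *)
pose e := (2 * M)^-1.
have e0 : 0 < e by rewrite invr_gt0 mulr_gt0// (lt_le_trans _ M1).
have eM : 2 * (e * M) = 1.
  by rewrite /e; field; rewrite gt_eqF// (lt_le_trans _ M1).
clearbody e.
have Pq v : 0 <= rip (P v) v by exact: positive_op_rip_ge0.
have Qq v : 0 <= rip (Q v) v by exact: positive_op_rip_ge0.
have e2 : 0 < e / 2 by rewrite divr_gt0.
pose T v := v + e%:C *: E v.
have PT v : rip (P (T v)) (T v) <= rip (P v) v - e / 2 * rip (E v) (E v).
  have h1 := ler_wpM2l (ltW e0) (PE v).
  have h2 := ler_wpM2l (sqr_ge0 e) (PM (E v)).
  rewrite /T bopD bopZ !ripE [rip (P (E v)) v](positive_op_sym P0) (ripC (E v)).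
  have h3 : e ^+ 2 * (M * rip (E v) (E v)) = e / 2 * rip (E v) (E v).
    by rewrite !mulrA; congr (_ * _); rewrite expr2 -mulrA; congr (_ * _); lra.
  move: h1 h2; rewrite h3 expr2; lra.
have QT v : rip (Q v) v + e * rip (E v) (E v) <= rip (Q (T v)) (T v).
  have h1 := ler_wpM2l (ltW e0) (QE v).
  have h2 := mulr_ge0 (sqr_ge0 e) (Qq (E v)).
  rewrite /T bopD bopZ !ripE [rip (Q (E v)) v](positive_op_sym Q0) (ripC (E v)).
  move: h1 h2; rewrite expr2; lra.
have ET v : E (T v) = T (E v) by rewrite /T bopD bopZ.
have QE0 v : rip (Q (E v)) (E v) = 0.
  (* Induction from [w] to [T w]: the [Q]-form at [E w] does not decrease, and each step costs [M]
     times the [P]-form at least [e/2] times it. The total budget is [M rip (P w) w]. *)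
  suff h n w : e / 2 * rip (Q (E w)) (E w) * n%:R <= M * rip (P w) w.
    have := archi_eq0 _ (h ^~ v) => /(_ (mulr_ge0 (ltW e2) (Qq _))).
    by move/eqP; rewrite mulf_eq0 gt_eqF//= => /eqP.
  elim: n w => [|n IH] w.
    by rewrite mulr0 mulr_ge0// ltW// (lt_le_trans _ M1).
  have h1 := IH (T w).
  have M0 : 0 <= M by lra.
  have h2 := ler_wpM2l M0 (PT w).
  have h3 := QT (E w); rewrite -ET in h3.
  have h4 := QM (E w).
  have h5 : rip (Q (E w)) (E w) <= rip (Q (E (T w))) (E (T w)).
    by apply: le_trans h3; rewrite lerDl mulr_ge0 ?rip_ge0// ltW.
  have n0 : 0 <= e / 2 * n%:R by rewrite mulr_ge0// ltW.
  have h6 := ler_wpM2l n0 h5.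
  have h7 := ler_wpM2l (ltW e2) h4.
  rewrite -[n.+1%:R]natr1; move: h1 h2 h6 h7.
  move: (n%:R) (rip (Q (E w)) _) (rip (Q (E (T w))) _) (rip (E w) _).
  by move: (rip (P (T w)) _) (rip (P w) _) => *; lra.
have EE v : E (E v) = 0.
  apply: rip_eq0; apply/eqP; rewrite eq_le rip_ge0 andbT.
  (* In [QT (E v)] both values of the [Q]-form vanish, as [T (E v) = E (T v)]; only
     [e |E (E v)|^2 <= 0] remains. *)
  by have := QT (E v); rewrite -ET !QE0 add0r pmulr_rle0.
apply: bop_ext => v; apply: rip_eq0.
suff h n w : e / 2 * rip (E w) (E w) * n%:R <= rip (P w) w.
  have := archi_eq0 _ (h ^~ v) => /(_ (mulr_ge0 (ltW e2) (rip_ge0 _))).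
  by move/eqP; rewrite mulf_eq0 gt_eqF//= => /eqP.
elim: n w => [|n IH] w; first by rewrite mulr0.
have ETw : E (T w) = E w by rewrite ET /T EE scaler0 addr0.
have := IH (T w); have := PT w; rewrite ETw -[n.+1%:R]natr1 => h1 h2.
move: h1 h2; move: (n%:R) => N *; lra.
Qed.

Lemma triangle_eq_polar H K (X Y : 'B(H, K)) :
  op_abs (X + Y) = op_abs X + op_abs Y ->
  exists W : 'B(H, K),
    [/\ partial_isometry W, X = W *o op_abs X & Y = W *o op_abs Y].
Proof.
set Z := X + Y => ZE.
have ZR v : rip (Z v) (Z v) <= 1 * rip (op_abs Z v) (op_abs Z v).
  by rewrite mul1r op_abs_rip.
have [G [GZ G_biperp G1]] := factor_adjoint ler01 ZR.
set Rz := op_abs Z in ZR GZ G_biperp *.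
pose W := adjoint G.
have WG : adjoint W = G by exact: adjointK.
have WR v : W (Rz v) = Z v.
  by apply: rip_injr => y; rewrite /W -rip_adjoint ripC /rip -GZ -/(rip _ _) ripC.
have GZR v : G (Z v) = Rz v.
  (* Both sides lie in the closed range of [Rz] and pair equally with it, since [Z] and [Rz] have
     the same Gram form. *)
  apply/eqP; rewrite -subr_eq0; apply/eqP; apply: (range_biperp_inner (T := Rz)).
    rewrite addrC -scaleN1r.
    by apply: range_biperp_lin; [exact: range_biperp_img|exact: G_biperp].
  move=> u; rewrite inner_Br -GZ; apply/eqP; rewrite subr_eq0; apply/eqP.
  by apply: inner_eq_of_rip => t; rewrite op_abs_rip.
have GW x y : rip (G x) y = rip x (W y) by rewrite rip_adjoint.
have W1 x : rip (W x) (W x) <= rip x x.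
  by have := adjoint_bound ltr01 G1 x; rewrite mul1r.
have PI : partial_isometry W.
  rewrite /partial_isometry WG; split; last first.
    apply: adjoint_unique => x y; rewrite !bop_compE GW.
    by rewrite [LHS]ripC -GW ripC.
  (* [G W] fixes every [z] in the closed range: ['[Rz u, G (W z)] = '[Z u, W z] = '[G (Z u), z] =
     '[Rz u, z]]. *)
  apply: bop_ext => x; rewrite !bop_compE; set z := G (W x).
  have zb : range_biperp Rz z by exact: G_biperp.
  apply/eqP; rewrite -subr_eq0; apply/eqP; apply: (range_biperp_inner (T := Rz)).
    rewrite addrC -scaleN1r.
    by apply: range_biperp_lin => //; exact: G_biperp.
  move=> u; rewrite inner_Br; apply/eqP; rewrite subr_eq0; apply/eqP.
  by apply: inner_eq_of_rip => t; rewrite ripC GW ripC WR -GW GZR.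
have GX v : rip (G (X v)) (G (X v)) <= rip (op_abs X v) (op_abs X v).
  by rewrite op_abs_rip; have := G1 (X v); rewrite mul1r.
have GY v : rip (G (Y v)) (G (Y v)) <= rip (op_abs Y v) (op_abs Y v).
  by rewrite op_abs_rip; have := G1 (Y v); rewrite mul1r.
(* The triangle equality enters here, through [G Z = Rz = |X| + |Y|]. *)
have GYE v : G (Y v) = op_abs Y v - (G (X v) - op_abs X v).
  have : G (X v) + G (Y v) = op_abs X v + op_abs Y v.
    by rewrite -bopD -bopDE GZR /Rz ZE.
  rewrite opprB addrA (addrC (op_abs Y v)) => <-.
  by rewrite addrAC subrr add0r.
(* Expanding [GX] and [GY] with [G X = |X| + E] and [G Y = |Y| - E] gives the two inequalities
   required. *)
have E0 : G *o X - op_abs X = 0.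
  apply: (@monotone_drift_eq0 _ (op_abs X) (op_abs Y)); try exact: (op_absP _).1.
  - move=> v; rewrite bopDE bopNE bop_compE ripBB ripDr ripNr.
    by rewrite (ripC (op_abs X v) (G _)); have := GX v; lra.
  - move=> v; rewrite bopDE bopNE bop_compE.
    by have := GY v; rewrite GYE ripBB; lra.
have GXE v : G (X v) = op_abs X v.
  by apply/eqP; rewrite -subr_eq0 -[_ - _]/((G *o X - op_abs X) v) E0.
(* Equality case for a contraction: [|V v - W |V| v|^2] expands to at most
   [(1 - 2 + 1) ||V| v|^2 = 0]. *)
have fac (V : 'B(H, K)) : (forall v, G (V v) = op_abs V v) -> V = W *o op_abs V.
  move=> GV; apply: bop_ext => v; rewrite bop_compE.
  apply/eqP; rewrite -subr_eq0; apply/eqP/rip_eq0/eqP.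
  rewrite eq_le rip_ge0 andbT ripBB -GW GV op_abs_rip.
  by have := W1 (op_abs V v); rewrite op_abs_rip; lra.
exists W; split => //; apply: fac => // v.
by rewrite GYE GXE subrr subr0.
Qed.

End TriangleEquality.

Theorem theorem1p12 (R : realType) (H : hilbertType R) (A B : 'B(H, H)) :
  op_qsym (A + B) = op_qsym A + op_qsym B ->
  (exists W : 'B(H, hsum H H),
     [/\ partial_isometry W,
         lifting A = W *o op_qsym A &
         lifting B = W *o op_qsym B]) /\
  ((exists W : 'B(H, hsum H H),
      [/\ partial_isometry W,
          lifting A = W *o op_qsym A &
          lifting B = W *o op_qsym B]) <->
   (exists W : 'B(H, hsum H H),
      polar_decomposition (lifting A) W /\
      polar_decomposition (lifting B) W)).
Proof.
rewrite !op_qsymE liftingD => /triangle_eq_polar ex.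
by split=> //; split=> [[W [WP AW BW]]|[W [[WP AW] [_ BW]]]]; exists W.
Qed.
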